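(* Consider $3\times3\times3$ zero-one tables with all two-dimensional marginals (line sums) fixed, i.e. the no-three-factor-interaction model. The set consisting of all basic moves, all degree 6 moves and all degree 9 moves of the types listed in the context forms a Markov basis for $3\times3\times3$ zero-one tables for this model. That is, whenever $\mathbf{x},\mathbf{y}\in\{0,1\}^{3\times3\times3}$ have the same line sums, there is a finite sequence $\mathbf{x}=\mathbf{x}_0,\mathbf{x}_1,\dots,\mathbf{x}_K=\mathbf{y}$ of zero-one tables, all with the same line sums as $\mathbf{x}$, such that each $\mathbf{x}_{k}-\mathbf{x}_{k-1}$ is $\pm$ a move in this set.
   Context: A table is $\mathbf{x}=(x_{ijk})_{i,j,k\in\{1,2,3\}}$. Its line sums are $x_{ij+}=\sum_k x_{ijk}$, $x_{i+k}=\sum_j x_{ijk}$, $x_{+jk}=\sum_i x_{ijk}$. A move for the no-three-factor-interaction model is an integer array $\mathbf{z}=(z_{ijk})$ all of whose line sums are zero. Arrays are displayed below as three consecutive $3\times3$ slices, for $i=1,2,3$, with rows indexed by $j$ and columns by $k$. ''Moves of a type'' means all arrays obtained from the displayed one by permuting the levels of each of the three indices, permuting the three axes, and changing the overall sign. Basic moves: type of $$\begin{pmatrix}1&-1&0\\-1&1&0\\0&0&0\end{pmatrix}\ \begin{pmatrix}-1&1&0\\1&-1&0\\0&0&0\end{pmatrix}\ \begin{pmatrix}0&0&0\\0&0&0\\0&0&0\end{pmatrix}.$$ Degree 6 moves: type of $$\begin{pmatrix}1&-1&0\\0&1&-1\\-1&0&1\end{pmatrix}\ \begin{pmatrix}-1&1&0\\0&-1&1\\1&0&-1\end{pmatrix}\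 \begin{pmatrix}0&0&0\\0&0&0\\0&0&0\end{pmatrix}.$$ Degree 9 moves: type of $$\begin{pmatrix}1&-1&0\\0&1&-1\\-1&0&1\end{pmatrix}\ \begin{pmatrix}0&1&-1\\-1&0&1\\1&-1&0\end{pmatrix}\ \begin{pmatrix}-1&0&1\\1&-1&0\\0&1&-1\end{pmatrix}.$$ *)

(* Defs.v *)
From mathcomp Require Import all_boot all_order all_algebra all_fingroup.
Set Implicit Arguments.
Unset Strict Implicit.
Unset Printing Implicit Defensive.
Import GRing.Theory.
Local Open Scope ring_scope.

(* The entry of z at (i, j, k) is z (i, j, k). *)
Notation array := {ffun 'I_3 * 'I_3 * 'I_3 -> int}.

Definition sum_k (x : array) (i j : 'I_3) : int := \sum_(k < 3) x (i, j, k).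
Definition sum_j (x : array) (i k : 'I_3) : int := \sum_(j < 3) x (i, j, k).
Definition sum_i (x : array) (j k : 'I_3) : int := \sum_(i < 3) x (i, j, k).

Definition same_line_sums (x y : array) : Prop :=
  [/\ forall i j, sum_k x i j = sum_k y i j,
      forall i k, sum_j x i k = sum_j y i k
    & forall j k, sum_i x j k = sum_i y j k].

Definition zero_one (x : array) : Prop := forall c, x c = 0 \/ x c = 1.

Definition is_move (z : array) : Prop :=
  [/\ forall i j, sum_k z i j = 0,
      forall i k, sum_j z i k = 0
    & forall j k, sum_i z j k = 0].

(* A display lists the slices i = 0, 1, 2, each one by rows j and columns k. *)
Definition array_of (d : seq (seq (seq int))) : array :=
  [ffun c : 'I_3 * 'I_3 * 'I_3 =>
     nth 0 (nth [::] (nth [::] d c.1.1) c.1.2) c.2].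

(* Levels of the three indices are permuted by p, q and r, and axes by s. *)
Definition permute_array (s p q r : 'S_3) (z : array) : array :=
  [ffun c : 'I_3 * 'I_3 * 'I_3 =>
     let c' := [tuple p c.1.1; q c.1.2; r c.2] in
     z (tnth c' (s 0), tnth c' (s 1), tnth c' (s 2))].

Definition of_type (z0 z : array) : Prop :=
  exists s p q r : 'S_3,
    z = permute_array s p q r z0 \/ z = - permute_array s p q r z0.

Definition basic_move : array -> Prop := of_type (array_of
  [:: [:: [::  1; -1;  0]; [:: -1;  1;  0]; [::  0;  0;  0]];
      [:: [:: -1;  1;  0]; [::  1; -1;  0]; [::  0;  0;  0]];
      [:: [::  0;  0;  0]; [::  0;  0;  0]; [::  0;  0;  0]]]).

Definition degree6_move : array -> Prop := of_type (array_of
  [:: [:: [::  1; -1;  0]; [::  0;  1; -1]; [:: -1;  0;  1]];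
      [:: [:: -1;  1;  0]; [::  0; -1;  1]; [::  1;  0; -1]];
      [:: [::  0;  0;  0]; [::  0;  0;  0]; [::  0;  0;  0]]]).

Definition degree9_move : array -> Prop := of_type (array_of
  [:: [:: [::  1; -1;  0]; [::  0;  1; -1]; [:: -1;  0;  1]];
      [:: [::  0;  1; -1]; [:: -1;  0;  1]; [::  1; -1;  0]];
      [:: [:: -1;  0;  1]; [::  1; -1;  0]; [::  0;  1; -1]]]).

Definition connected_by (B : array -> Prop) (x y : array) : Prop :=
  exists (K : nat) (w : nat -> array),
    [/\ w 0%N = x, w K = y,
        forall k, (k <= K)%N -> zero_one (w k) /\ same_line_sums (w k) x
      & forall k, (k < K)%N ->
          B (w k.+1 - w k) \/ B (- (w k.+1 - w k))].

Definition zero_one_markov_basis (B : array -> Prop) : Prop :=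
  (forall z, B z -> is_move z) /\
  (forall x y : array, zero_one x -> zero_one y -> same_line_sums x y ->
     connected_by B x y).

(* Main.v *)
(* If x and y have the same line sums then z = x - y is a move with entries in
   {-1, 0, 1}.  A move is determined by its 2 x 2 x 2 corner, so there are only
   403 such z: zero, the basic, degree 6 and degree 9 moves, and 216 moves of
   degree 7.  A degree 7 move is a sum m + m' of two basic moves whose supports
   share a single cell c, where m c = 1 and m' c = -1.  Since x c = y c, one goes
   from x to y through x - m if x c = 1 and through x - m' if x c = 0. *)
Require Import Defs.
From mathcomp Require Import all_boot all_order all_algebra all_fingroup.
From mathcomp Require Import zify.
Set Implicit Arguments.
Unset Strict Implicit.
Unset Printing Implicit Defensive.
Import GRing.Theory.
Local Open Scope ring_scope.

(** * Displays: nested lists that compute, in place of arrays, which do not *)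

Notation display := (seq (seq (seq int))).

Definition entry (d : display) (i j k : nat) : int :=
  nth 0 (nth [::] (nth [::] d i) j) k.

Definition display_of (f : nat -> nat -> nat -> int) : display :=
  mkseq (fun i => mkseq (fun j => mkseq (f i j) 3) 3) 3.

Lemma entry_display_of f i j k :
  (i < 3)%N -> (j < 3)%N -> (k < 3)%N -> entry (display_of f) i j k = f i j k.
Proof. by move=> ? ? ?; rewrite /entry !nth_mkseq. Qed.

Lemma array_ofE d (i j k : 'I_3) : array_of d (i, j, k) = entry d i j k.
Proof. by rewrite ffunE. Qed.

Lemma array_of_display_of (f : nat -> nat -> nat -> int) (x : array) :
  (forall i j k : 'I_3, f i j k = x (i, j, k)) -> array_of (display_of f) = x.
Proof.
by move=> fx; apply/ffunP=> -[[i j] k]; rewrite array_ofE entry_display_of.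
Qed.

Definition opp_display (d : display) : display :=
  display_of (fun i j k => - entry d i j k).

Lemma array_of_opp d : array_of (opp_display d) = - array_of d.
Proof. by apply: array_of_display_of => i j k; rewrite !ffunE. Qed.

Definition sub_display (d e : display) : display :=
  display_of (fun i j k => entry d i j k - entry e i j k).

Lemma array_of_sub d e : array_of (sub_display d e) = array_of d - array_of e.
Proof. by apply: array_of_display_of => i j k; rewrite !ffunE. Qed.

(** * Orbits of a display under permutations and sign *)

Definition perm_seq n (s : 'S_n) : seq nat := [seq val (s i) | i <- enum 'I_n].

Lemma nth_perm_seq n (s : 'S_n) (i : 'I_n) : nth 0%N (perm_seq s) i = s i.
Proof. by rewrite (nth_map i) ?size_enum_ord // nth_ord_enum. Qed.

(** Together with [permutations_perm_seq], this lets the computable list [permutations (iota 0 n)]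
    replace ['S_n], each permutation being read in one-line notation. *)
Lemma perm_seq_permutations n (s : 'S_n) :
  perm_seq s \in permutations (iota 0 n).
Proof.
have uniq_s : uniq (perm_seq s).
  by rewrite map_inj_uniq ?enum_uniq // => i j /val_inj /perm_inj.
rewrite mem_permutations uniq_perm ?iota_uniq // => k.
rewrite mem_iota /= add0n; apply/mapP/idP=> [[i _ ->] | lt_kn]; first exact: ltn_ord.
exists (s^-1 (Ordinal lt_kn))%g; first by rewrite mem_enum.
by rewrite permKV.
Qed.

Lemma permutations_perm_seq n l :
  l \in permutations (iota 0 n) -> exists s : 'S_n, perm_seq s = l.
Proof.
rewrite mem_permutations => perm_l.
have size_l : size l = n by rewrite (perm_size perm_l) size_iota.
have lt_l (i : 'I_n) : (nth 0%N l i < n)%N.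
  have: nth 0%N l i \in l by rewrite mem_nth ?size_l.
  by rewrite (perm_mem perm_l) mem_iota.
have inj_l : injective (fun i => Ordinal (lt_l i)).
  move=> i j [] /eqP; rewrite nth_uniq ?size_l //; first by move/eqP/val_inj.
  by rewrite (perm_uniq perm_l) iota_uniq.
exists (perm inj_l); apply: (@eq_from_nth _ 0%N).
  by rewrite size_map size_enum_ord size_l.
move=> i; rewrite size_map size_enum_ord => lt_in.
by rewrite -[i]/(val (Ordinal lt_in)) nth_perm_seq permE.
Qed.

Definition permute_display (s p q r : seq nat) (d : display) : display :=
  display_of (fun i j k =>
    let c := [:: nth 0%N p i; nth 0%N q j; nth 0%N r k] in
    entry d (nth 0%N c (nth 0%N s 0)) (nth 0%N c (nth 0%N s 1))
      (nth 0%N c (nth 0%N s 2))).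

Lemma array_of_permute (s p q r : 'S_3) d :
  array_of (permute_display (perm_seq s) (perm_seq p) (perm_seq q) (perm_seq r) d)
  = permute_array s p q r (array_of d).
Proof.
apply: array_of_display_of => i j k; rewrite ffunE /=.
have tnthE (a b c t : 'I_3) :
    nth 0%N [:: a : nat; b : nat; c : nat] t = tnth [tuple a; b; c] t.
  by rewrite (tnth_nth a) -(nth_map _ 0%N val).
by rewrite array_ofE -!tnthE -!nth_perm_seq.
Qed.

(* [undup] compares each element with the whole tail, duplicates included, which
   is too slow for the orbits below. *)
Definition dedup (T : eqType) : seq T -> seq T :=
  foldr (fun x s => if x \in s then s else x :: s) [::].

Lemma mem_dedup (T : eqType) (s : seq T) : dedup s =i s.
Proof.
elim: s => //= x s IHs y; rewrite inE -IHs -/(dedup s).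
by case: ifP => [x_in|]; rewrite ?inE //; case: eqP => // ->.
Qed.

Definition orbit_display (d : display) : seq display :=
  let S3 := permutations (iota 0 3) in
  let S3xS3 := [seq (s, t) | s <- S3, t <- S3] in
  let o := [seq permute_display u.1 u.2 v.1 v.2 d | u <- S3xS3, v <- S3xS3] in
  dedup (o ++ [seq opp_display e | e <- o]).

(** Turns the existential over four permutations and a sign into membership in a list, so that
    statements about a whole type of moves can be settled by evaluation. *)
Lemma orbit_displayP d z :
  of_type (array_of d) z <->
  exists2 e, e \in orbit_display d & z = array_of e.
Proof.
rewrite /orbit_display.
(* Generalizing the list of permutations keeps it from being computed. *)
move: (permutations _) (@perm_seq_permutations 3) (@permutations_perm_seq 3).
move=> S3 perm_seq_S3 S3_perm_seq; set S3xS3 := [seq (s, t) | s <- S3, t <- S3].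
set o := [seq permute_display u.1 u.2 v.1 v.2 d | u <- S3xS3, v <- S3xS3].
split=> [[s [p [q [r z_def]]]] | [e]].
- set e := permute_display (perm_seq s) (perm_seq p) (perm_seq q) (perm_seq r) d.
  have in_S3xS3 (s' t' : 'S_3) : (perm_seq s', perm_seq t') \in S3xS3.
    by rewrite allpairs_f ?perm_seq_S3.
  have e_in : e \in o.
    by apply/allpairsP; exists ((perm_seq s, perm_seq p), (perm_seq q, perm_seq r));
      split=> //; apply: in_S3xS3.
  case: z_def => ->; rewrite -array_of_permute -/e.
    by exists e; rewrite // mem_dedup mem_cat e_in.
  exists (opp_display e); last by rewrite array_of_opp.
  by rewrite mem_dedup mem_cat map_f ?orbT.
- have o_permute e' : e' \in o ->
      exists s p q r : 'S_3, array_of e' = permute_array s p q r (array_of d).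
    case/allpairsP=> -[u v] /= [/allpairsP[[s p] [/= Ss Sp ->]]].
    case/allpairsP=> -[q r] /= [Sq Sr ->] -> /=.
    have [s' <-] := S3_perm_seq _ Ss.
    have [p' <-] := S3_perm_seq _ Sp.
    have [q' <-] := S3_perm_seq _ Sq.
    have [r' <-] := S3_perm_seq _ Sr.
    by exists s', p', q', r'; rewrite array_of_permute.
  rewrite mem_dedup mem_cat => /orP[/o_permute | /mapP[e' /o_permute]] [s [p [q [r eE]]]].
    by move=> ->; exists s, p, q, r; left.
  by move=> -> ->; exists s, p, q, r; right; rewrite array_of_opp eE.
Qed.

(** * Line sums and the list of allowed moves *)

Lemma sum_ord3 (f : 'I_3 -> int) :
  \sum_i f i = f (@Ordinal 3 0 isT) + f (@Ordinal 3 1 isT) + f (@Ordinal 3 2 isT).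
Proof.
rewrite !big_ord_recl big_ord0 addr0 addrA.
by congr (_ + _ + _); congr f; apply: val_inj.
Qed.

Definition zero_line_sums (d : display) : bool :=
  all (fun i => all (fun j =>
    [&& entry d i j 0 + entry d i j 1 + entry d i j 2 == 0,
        entry d i 0 j + entry d i 1 j + entry d i 2 j == 0
      & entry d 0 i j + entry d 1 i j + entry d 2 i j == 0])
  (iota 0 3)) (iota 0 3).

Lemma zero_line_sums_is_move d : zero_line_sums d -> is_move (array_of d).
Proof.
move=> /allP d0.
have {}d0 (i j : 'I_3) :
    [&& entry d i j 0 + entry d i j 1 + entry d i j 2 == 0,
        entry d i 0 j + entry d i 1 j + entry d i 2 j == 0
      & entry d 0 i j + entry d 1 i j + entry d 2 i j == 0].
  have in3 (l : 'I_3) : val l \in iota 0 3 by rewrite mem_iota ltn_ord.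
  by have /allP := d0 i (in3 i); apply; apply: in3.
split=> i j; rewrite /sum_k /sum_j /sum_i sum_ord3 !array_ofE /=;
  by case/and3P: (d0 i j) => /eqP ? /eqP ? /eqP ?.
Qed.

(** This literal and the next two repeat those inside the three types of moves, so [listed_moveP]
    can identify them by conversion. *)
Definition basic_display : display :=
  [:: [:: [::  1; -1;  0]; [:: -1;  1;  0]; [::  0;  0;  0]];
      [:: [:: -1;  1;  0]; [::  1; -1;  0]; [::  0;  0;  0]];
      [:: [::  0;  0;  0]; [::  0;  0;  0]; [::  0;  0;  0]]].

Definition degree6_display : display :=
  [:: [:: [::  1; -1;  0]; [::  0;  1; -1]; [:: -1;  0;  1]];
      [:: [:: -1;  1;  0]; [::  0; -1;  1]; [::  1;  0; -1]];
      [:: [::  0;  0;  0]; [::  0;  0;  0]; [::  0;  0;  0]]].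

Definition degree9_display : display :=
  [:: [:: [::  1; -1;  0]; [::  0;  1; -1]; [:: -1;  0;  1]];
      [:: [::  0;  1; -1]; [:: -1;  0;  1]; [::  1; -1;  0]];
      [:: [:: -1;  0;  1]; [::  1; -1;  0]; [::  0;  1; -1]]].

Definition listed_displays : seq display :=
  orbit_display basic_display ++
  orbit_display degree6_display ++ orbit_display degree9_display.

Definition listed_move (z : array) : Prop :=
  [\/ basic_move z, degree6_move z | degree9_move z].

Lemma listed_moveP z :
  listed_move z <-> exists2 e, e \in listed_displays & z = array_of e.
Proof.
rewrite /listed_displays.
(* Generalizing the orbits keeps them from being computed. *)
move: (orbit_displayP basic_display z) (orbit_displayP degree6_display z)
      (orbit_displayP degree9_display z).
move: (orbit_display _) (orbit_display _) (orbit_display _) => o o' o'' oP o'P o''P.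
split=> [[/oP | /o'P | /o''P] [e e_in ->] | [e]].
1-3: by exists e; rewrite // !mem_cat e_in ?orbT.
rewrite !mem_cat => /or3P[] e_in z_e; [apply/Or31/oP | apply/Or32/o'P | apply/Or33/o''P];
  by exists e.
Qed.

(** The line sums are evaluated on every display of the three orbits. *)
Lemma listed_move_is_move z : listed_move z -> is_move z.
Proof.
case/listed_moveP=> e; have: all zero_line_sums listed_displays by vm_compute.
by move=> /allP e0 /e0 /zero_line_sums_is_move + ->.
Qed.

(** * Enumeration of the moves with entries in {-1, 0, 1} *)

(* The completion of the corner [a b; c d] of a slice with zero row and column
   sums. *)
Definition slice (a b c d : int) : seq (seq int) :=
  [:: [:: a; b; - (a + b)]; [:: c; d; - (c + d)];
      [:: - (a + c); - (b + d); a + b + c + d]].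

Definition signs : seq int := [:: 0; 1; -1].

Definition slices : seq (seq (seq int)) :=
  [seq m <- [seq slice u.1 u.2 v.1 v.2 |
             u <- [seq (a, b) | a <- signs, b <- signs],
             v <- [seq (c, d) | c <- signs, d <- signs]]
  | all (all (mem signs)) m].

(** The third slice is forced by the first two. Filtering the slices beforehand leaves far fewer
    pairs than the 3^8 possible corners. *)
Definition sign_moves : seq display :=
  [seq d <- [seq [:: m; n; mkseq (fun j => mkseq (fun k =>
               - (nth 0 (nth [::] m j) k + nth 0 (nth [::] n j) k)) 3) 3] |
             m <- slices, n <- slices]
  | all (all (all (mem signs))) d].

(* The enumeration of 'I_3 does not compute, hence the explicit list. *)
Definition levels : seq 'I_3 :=
  [:: @Ordinal 3 0 isT; @Ordinal 3 1 isT; @Ordinal 3 2 isT].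

Definition cells : seq ('I_3 * 'I_3 * 'I_3) :=
  [seq (ij, k) | ij <- [seq (i, j) | i <- levels, j <- levels], k <- levels].

Lemma mem_cells c : c \in cells.
Proof.
have in_levels (i : 'I_3) : i \in levels by case: i => [] [|[|[]]].
by case: c => [[i j] k]; rewrite !allpairs_f.
Qed.

Definition entry_at (d : display) (c : 'I_3 * 'I_3 * 'I_3) : int :=
  entry d c.1.1 c.1.2 c.2.

Definition splits (B : seq display) (z m : display) : bool :=
  let n := sub_display z m in
  (* The conditionals, unlike [&&], stop the evaluation by vm_compute early. *)
  if all (all (all (mem signs))) n then
    if n \in B then
      has (fun c => [&& entry_at m c == 1, entry_at n c == -1
        & all (fun c' => [|| c' == c, entry_at m c' == 0 | entry_at n c' == 0])
            cells])
      cells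
    else false
  else false.

Definition zero_display : display := display_of (fun _ _ _ => 0).

(** Exhaustive evaluation over [sign_moves]; the summands of a split are sought among basic moves
    only. Passing the two orbit lists as arguments of [check] has them evaluated once rather than
    for each [z]. *)
Lemma sign_moves_split :
  let check L B := all (fun z =>
    if z \in zero_display :: L then true else has (splits B z) B) sign_moves in
  check listed_displays (orbit_display basic_display).
Proof. by vm_compute. Qed.

Lemma mem_slices (f : nat -> nat -> int) :
  (forall j k, (j < 3)%N -> (k < 3)%N -> f j k \in signs) ->
  (forall j, (j < 3)%N -> f j 0%N + f j 1%N + f j 2%N = 0) ->
  (forall k, (k < 3)%N -> f 0%N k + f 1%N k + f 2%N k = 0) ->
  mkseq (fun j => mkseq (f j) 3) 3 \in slices.
Proof.
move=> f_sign f_row f_col; rewrite mem_filter; apply/andP; split.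
  by rewrite /= !f_sign.
apply/allpairsP; exists ((f 0 0, f 0 1), (f 1 0, f 1 1))%N.
split; try by apply: allpairs_f; apply: f_sign.
(* These five sums determine the five entries outside the corner. *)
have := (f_row 0 isT, f_row 1 isT, f_row 2 isT, f_col 0 isT, f_col 1 isT)%N.
rewrite /slice /mkseq /= => -[[[[? ?] ?] ?] ?].
by congr [:: [:: _; _; _]; [:: _; _; _]; [:: _; _; _]]; lia.
Qed.

Lemma mem_sign_moves (z : array) :
  is_move z -> (forall c, z c \in signs) ->
  exists2 d, d \in sign_moves & array_of d = z.
Proof.
case=> z_k z_j z_i z_sign.
(* [inord] sends any number above 2 to a level as well, so the sums below vanish for all natural
   indices, without bounds. *)
pose f i j k := z (inord i, inord j, inord k).
exists (display_of f); last by apply: array_of_display_of => i j k; rewrite /f !inord_val.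
have inordE k (lt_k3 : (k < 3)%N) : inord k = Ordinal lt_k3.
  by apply: val_inj; rewrite /= inordK.
have ordE := (inordE 0 isT, inordE 1 isT, inordE 2 isT)%N.
have f_i j k : f 0%N j k + f 1%N j k + f 2%N j k = 0.
  by rewrite -[RHS](z_i (inord j) (inord k)) /sum_i sum_ord3 /f !ordE.
have f_j i k : f i 0%N k + f i 1%N k + f i 2%N k = 0.
  by rewrite -[RHS](z_j (inord i) (inord k)) /sum_j sum_ord3 /f !ordE.
have f_k i j : f i j 0%N + f i j 1%N + f i j 2%N = 0.
  by rewrite -[RHS](z_k (inord i) (inord j)) /sum_k sum_ord3 /f !ordE.
rewrite mem_filter; apply/andP; split; first by rewrite /= !z_sign.
apply/allpairsP.
exists (mkseq (fun j => mkseq (f 0 j) 3) 3, mkseq (fun j => mkseq (f 1 j) 3) 3)%N.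
split; try by apply: mem_slices => *; [apply: z_sign | apply: f_k | apply: f_j].
have f2 j k : f 2%N j k = - (f 0%N j k + f 1%N j k) by have := f_i j k; lia.
by rewrite /display_of /mkseq /= !f2.
Qed.

Lemma sign_move_cases (z : array) : is_move z -> (forall c, z c \in signs) ->
  [\/ z = 0, listed_move z
    | exists m n c, [/\ listed_move m /\ listed_move n, z = m + n,
        m c = 1 /\ n c = -1 & forall c', c' != c -> m c' = 0 \/ n c' = 0]].
Proof.
move=> z0 z_sign; have [d] := mem_sign_moves z0 z_sign.
move: sign_moves_split (listed_moveP z) (fun e => orbit_displayP basic_display (array_of e)).
(* Once the lists are variables, [/=] unfolds the check without computing them. *)
move: (orbit_display basic_display) listed_displays sign_moves => B L Z /=.
move=> /allP Z_split z_listed B_basic {}/Z_split.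
have entryE e c : entry_at e c = array_of e c by rewrite ffunE.
case: ifP => [+ _ | _ /hasP[m m_B]].
  rewrite inE => /predU1P[-> <- | d_L dE].
    by apply: Or31; apply: array_of_display_of => i j k; rewrite ffunE.
  by apply: Or32; apply/z_listed; exists d.
rewrite /splits; case: ifP => // _; case: ifP => // n_B.
case/hasP=> c _ /and3P[]; rewrite !entryE => /eqP mc /eqP nc /allP disj <-.
apply: Or33; exists (array_of m), (array_of (sub_display d m)), c; split=> //.
- by split; apply: Or31; apply/B_basic; [exists m | exists (sub_display d m)].
- by rewrite array_of_sub addrC subrK.
move=> c' /negPf c'c; have := disj c' (mem_cells c').
by rewrite c'c !entryE /= => /orP[] /eqP; [left | right].
Qed.

(** * Walks between zero-one tables *)

Lemma sub_is_move x y : is_move (x - y) <-> same_line_sums x y.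
Proof.
have subE (I : finType) (F : I -> 'I_3 * 'I_3 * 'I_3) :
    \sum_i (x - y) (F i) = \sum_i x (F i) - \sum_i y (F i).
  by rewrite -sumrB; apply: eq_bigr => i _; rewrite !ffunE.
rewrite /is_move /same_line_sums /sum_k /sum_j /sum_i.
split=> -[xy_k xy_j xy_i]; split=> a b; apply/eqP.
- by rewrite -subr_eq0 -subE xy_k.
- by rewrite -subr_eq0 -subE xy_j.
- by rewrite -subr_eq0 -subE xy_i.
- by rewrite subE subr_eq0 xy_k.
- by rewrite subE subr_eq0 xy_j.
- by rewrite subE subr_eq0 xy_i.
Qed.

Lemma connected_refl (B : array -> Prop) x : zero_one x -> connected_by B x x.
Proof. by move=> x01; exists 0%N, (fun=> x); split=> // k; split. Qed.

Lemma connected_step (B : array -> Prop) x u y :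
  zero_one x -> B (x - u) -> is_move (x - u) ->
  connected_by B u y -> connected_by B x y.
Proof.
move=> x01 Bxu /sub_is_move[xu_k xu_j xu_i] [K [w [w0 wK w01 wB]]].
exists K.+1, (fun k => if k is k'.+1 then w k' else x); split=> // -[|k] //.
- by move=> /w01[wk01 [wu_k wu_j wu_i]]; split=> //; split=> a b;
    rewrite (wu_k, wu_j, wu_i) (xu_k, xu_j, xu_i).
(* The first difference of the extended walk is [u - x], so [B] holds of its opposite. *)
- by rewrite w0 opprB; right.
- exact: wB.
Qed.

Theorem proposition3p1 :
  zero_one_markov_basis
    (fun z : array => [\/ basic_move z, degree6_move z | degree9_move z]).
Proof.
rewrite -/listed_move; split=> [z | x y x01 y01 xy]; first exact: listed_move_is_move.
have z_sign c : (x - y) c \in signs.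
  by rewrite !ffunE; case: (x01 c) => ->; case: (y01 c) => ->.
have yy : connected_by listed_move y y := connected_refl _ y01.
case: (sign_move_cases (iffRL (sub_is_move x y) xy) z_sign) =>
  [/eqP | xy_move | [m [n [c [[m_move n_move] xy_mn [mc nc] disj]]]]].
- by rewrite subr_eq0 => /eqP ->.
- exact: connected_step (listed_move_is_move xy_move) yy.
(* Stated for arbitrary [u] and [v] so that [m] and [n] can be subtracted in either order. *)
have via u v : listed_move u -> listed_move v -> x - y = u + v ->
    x c - u c = 0 \/ x c - u c = 1 ->
    (forall c', c' != c -> u c' = 0 \/ v c' = 0) -> connected_by listed_move x y.
  move=> u_move v_move xy_uv xuc uv_disj.
  have step1 : x - (x - u) = u by rewrite subKr.
  have step2 : x - u - y = v by rewrite addrAC xy_uv addrC addKr.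
  apply: (@connected_step _ x (x - u)); rewrite ?step1 //.
    exact: listed_move_is_move.
  apply: (@connected_step _ _ y); rewrite ?step2 //; last exact: listed_move_is_move.
  (* Away from [c], the middle table [x - u] agrees with [x] where [u] vanishes and with [y] where
     [v] vanishes, so it stays zero-one. *)
  move=> c'; rewrite !ffunE; have [-> // | /uv_disj uv0] := eqVneq c' c.
  have := congr1 (fun w : array => w c') xy_uv; rewrite !ffunE.
  by case: uv0 => ->; [rewrite subr0 | rewrite addr0 => <-; rewrite subKr].
case: (x01 c) => xc.
  apply: (via n m) => //; first by rewrite [n + m]addrC.
    by right; rewrite xc nc.
  by move=> c' /disj[]; [right | left].
by apply: (via m n) => //; left; rewrite xc mc.
Qed.
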